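(* Let $(T_1,\ldots,T_N)$ be an affine iterated function system acting on $\mathbb{R}^2$, i.e. a finite collection of affine contractions $T_i\colon\mathbb{R}^2\to\mathbb{R}^2$. Let $v_1,\ldots,v_N\in\mathbb{R}^2$ and $A_1,\ldots,A_N\in M_2(\mathbb{R})$ be such that $T_ix=A_ix+v_i$ for every $x\in\mathbb{R}^2$. Suppose that for some integer $k\in\{0,\ldots,N\}$ we have $$A_i=\begin{pmatrix}a_i&0\\0&d_i\end{pmatrix}\text{ when }1\le i\le k,\qquad A_i=\begin{pmatrix}0&b_i\\c_i&0\end{pmatrix}\text{ when }k+1\le i\le N,$$ where each $a_i,b_i,c_i,d_i$ is nonzero. Then the affinity dimension of $(A_1,\ldots,A_N)$ is the unique real number $s>0$ such that one of the following holds: (1) the matrix $$\begin{pmatrix}\sum_{i=1}^k|a_i|^s&\sum_{i=k+1}^N|b_i|^s\\ \sum_{i=k+1}^N|c_i|^s&\sum_{i=1}^k|d_i|^s\end{pmatrix}$$ has spectral radius $1$, and $0<s\le 1$; or (2) the matrix $$\begin{pmatrix}\sum_{i=1}^k|a_i||d_i|^{s-1}&\sum_{i=k+1}^N|b_i||c_i|^{s-1}\\ \sum_{i=k+1}^N|b_i|^{s-1}|c_i|&\sum_{i=1}^k|a_i|^{s-1}|d_i|\end{pmatrix}$$ has spectral radius $1$, and $1\le s\le 2$; or (3) $\sum_{i=1}^N|\det A_i|^{s/2}=1$ and $s\ge 2$.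
   Context: $M_d(\mathbb{R})$ denotes the space of $d\times d$ real matrices. Since each $T_i$ is a contraction, its linear part satisfies $\|A_i\|<1$ in Euclidean operator norm. The singular values $\alpha_1(A)\ge\cdots\ge\alpha_d(A)\ge 0$ of $A\in M_d(\mathbb{R})$ are the non-negative square roots of the eigenvalues of $A^TA$, listed in decreasing order with multiplicity. For real $s\ge 0$ the singular value function is $\varphi^s(A):=\alpha_1(A)\cdots\alpha_{\lfloor s\rfloor}(A)\,\alpha_{\lceil s\rceil}(A)^{s-\lfloor s\rfloor}$ if $0\le s\le d$ (the last factor being $1$ when $s$ is an integer, so in particular $\varphi^0\equiv 1$), and $\varphi^s(A):=|\det A|^{s/d}$ if $s\ge d$. Here $d=2$. For $\mathsf{A}=(A_1,\ldots,A_N)\in M_d(\mathbb{R})^N$ and $s\ge 0$ the pressure is the limit (which exists by subadditivity) $$P(\mathsf{A},s):=\lim_{n\to\infty}\frac1n\log\sum_{i_1,\ldots,i_n=1}^N\varphi^s(A_{i_n}\cdots A_{i_1}).$$ When the $A_i$ are the invertible linear parts of affine contractions, $s\mapsto P(\mathsf{A},s)$ is continuous and strictly decreasing, and the affinity dimension of $(T_1,\ldots,T_N)$ (also called the affinity dimension of $(A_1,\ldots,A_N)$) is defined to be the unique $s\ge 0$ such that $P(\mathsf{A},s)=0$. Empty sums equal $0$.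
   Formalization: The affine iterated function system is assumed to have N ≥ 2 maps: for N = 1 the affinity dimension is 0 and no s > 0 satisfies (1)–(3), and for N = 0 the pressure is −∞, so the claim fails there. *)

(* Defs.v *)
From HB Require Import structures.
From mathcomp Require Import all_boot all_order all_algebra.
From mathcomp Require Import polyrcf complex.
From mathcomp Require Import all_classical all_reals all_analysis.
Set Implicit Arguments.
Unset Strict Implicit.
Unset Printing Implicit Defensive.
Import Order.TTheory GRing.Theory Num.Theory.
Import numFieldNormedType.Exports.
Local Open Scope classical_set_scope.
Local Open Scope ring_scope.

(* The norm provided by the library on 'cV[R]_d is the sup norm. *)
Definition euclidean_norm (R : realType) (d : nat) (x : 'cV[R]_d) : R :=
  Num.sqrt (\sum_(i < d) x i ord0 ^+ 2).

Definition euclidean_contraction (R : realType) (d : nat)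
    (f : 'cV[R]_d -> 'cV[R]_d) : Prop :=
  exists2 q : R, 0 <= q < 1 &
    forall x y, euclidean_norm (f x - f y) <= q * euclidean_norm (x - y).

(* [rootsR] lists the distinct real roots; [A^T *m A] is symmetric, hence
   diagonalizable over R, so the multiplicity of an eigenvalue is its
   multiplicity as a root of the characteristic polynomial. *)
Definition singular_values (R : realType) (d : nat) (A : 'M[R]_d) : seq R :=
  let p := char_poly (A^T *m A) in
  sort >=%O (flatten [seq nseq (mup x p) (Num.sqrt x) | x <- rootsR p]).

(* Numbered from 1. *)
Definition singular_value (R : realType) (d : nat) (A : 'M[R]_d) (i : nat) : R :=
  (singular_values A)`_i.-1.

(* When s is an integer the last factor is x `^ 0 = 1, whatever x is; this
   covers s = 0, where the index of that factor is the meaningless 0. *)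
Definition singular_value_function (R : realType) (d : nat) (s : R)
    (A : 'M[R]_d) : R :=
  if s <= d%:R then
    (\prod_(1 <= i < (Num.truncn s).+1) singular_value A i)
      * singular_value A `|Num.ceil s|%N `^ (s - (Num.truncn s)%:R)
  else `|\det A| `^ (s / d%:R).

(* A_{i_n} ... A_{i_1} for the word w = (i_1, ..., i_n). *)
Definition word_product (R : realType) (d N n : nat) (A : 'I_N -> 'M[R]_d)
    (w : n.-tuple 'I_N) : 'M[R]_d :=
  \big[mulmx/1%:M]_(i <- rev w) A i.

(* [pressure_is A s p] says that the limit defining P(A, s) exists and equals p.
   It is taken in the extended reals, with log 0 = -oo, so that the definition
   is also correct for tuples of singular matrices. *)
Definition pressure_is (R : realType) (d N : nat) (A : 'I_N -> 'M[R]_d) (s : R)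
    (p : \bar R) : Prop :=
  (fun n : nat => (n%:R^-1)%:E
     * lne (\sum_(w : n.-tuple 'I_N)
              singular_value_function s (word_product A w))%:E)%E
    @ \oo --> p.

Definition is_affinity_dimension (R : realType) (d N : nat)
    (A : 'I_N -> 'M[R]_d) (s : R) : Prop :=
  unique (fun t : R => 0 <= t /\ pressure_is A t 0%E) s.

(* The supremum is a maximum over the finite set of complex eigenvalues. *)
Definition spectral_radius (R : realType) (d : nat) (M : 'M[R]_d) : R :=
  sup [set ComplexField.Normc.normc z | z in
         [set z : R[i] | eigenvalue (map_mx (real_complex R) M) z]].

Definition mx2 (R : realType) (a b c d : R) : 'M[R]_2 :=
  \matrix_(i < 2, j < 2)
    if i == ord0 then (if j == ord0 then a else b)
    else (if j == ord0 then c else d).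

(* Main.v *)
Require Import Defs.
From HB Require Import structures.
From mathcomp Require Import all_boot all_order all_algebra.
From mathcomp Require Import polyrcf complex.
From mathcomp Require Import all_classical all_reals all_analysis.
From mathcomp Require Import ring lra.
Set Implicit Arguments.
Unset Strict Implicit.
Unset Printing Implicit Defensive.
Import Order.TTheory GRing.Theory Num.Theory.
Import numFieldNormedType.Exports.
Local Open Scope classical_set_scope.
Local Open Scope ring_scope.

(* For a generalized permutation matrix with entries of absolute values u, v in
   rows 1 and 2, phi^s is the maximum of the weights wt s u v and wt s v u.
   These weights are multiplicative, so replacing (u, v) by (wt s u v, wt s v u)
   in each A_i gives nonnegative matrices M_i whose products dominate phi^s of
   the corresponding products of the A_i within a factor 2. Summing over words of
   length n gives the entry sum of (sum_i M_i)^n, which grows like rho(s)^n with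
   rho(s) the spectral radius of sum_i M_i; hence P(A, s) = ln rho(s). Each of the
   three conditions of the theorem is rho(s) = 1. Finally, if all entries have
   absolute value in [m, Q] with Q < 1, then
   m^(t-s) rho(s) <= rho(t) <= Q^(t-s) rho(s) for s <= t, so ln rho is Lipschitz
   and decreases to -oo from ln rho(0) = ln N > 0. *)

(** * Spectral radius of a nonnegative two by two matrix *)

(* The larger root of the characteristic polynomial of [mx2 p q r t]. *)
Definition rho (R : realType) (p q r t : R) : R :=
  (p + t + Num.sqrt ((p - t) ^+ 2 + 4 * (q * r))) / 2.

Lemma det_mx2 (K : comNzRingType) (B : 'M[K]_2) :
  \det B = B ord0 ord0 * B ord_max ord_max - B ord0 ord_max * B ord_max ord0.
Proof.
rewrite (expand_det_row B ord0) !big_ord_recl big_ord0 addr0 /cofactor !det_mx11 !mxE /=.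
rewrite expr0 mul1r expr1 mulN1r mulrN.
by congr (_ * B _ _ - B _ _ * B _ _); apply/val_inj.
Qed.

Section PerronRoot.
Variables (R : realType) (p q r t : R).
Hypotheses (p0 : 0 <= p) (q0 : 0 <= q) (r0 : 0 <= r) (t0 : 0 <= t).

Local Notation toC := (real_complex R).

Let disc_ge0 : 0 <= (p - t) ^+ 2 + 4 * (q * r).
Proof. by apply: addr_ge0; rewrite ?sqr_ge0 ?mulr_ge0. Qed.

(** Stating the characteristic equation through the gaps to the diagonal entries lets [rho_mono] and
    [rho_growth] work without the square root. *)
Lemma rho_root : (rho p q r t - p) * (rho p q r t - t) = q * r.
Proof.
have := sqr_sqrtr disc_ge0; rewrite /rho.
set d := Num.sqrt _ => d2.
have -> : ((p + t + d) / 2 - p) * ((p + t + d) / 2 - t)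
  = (d ^+ 2 - (p - t) ^+ 2) / 4 by field.
by rewrite d2; field.
Qed.

(** The discriminant is at least (p - t)^2 because q r is nonnegative. *)
Lemma rho_ge_diag : p <= rho p q r t /\ t <= rho p q r t.
Proof.
have h : `|p - t| <= Num.sqrt ((p - t) ^+ 2 + 4 * (q * r)).
  by rewrite -sqrtr_sqr ler_sqrt // lerDl !mulr_ge0.
move: h; rewrite ler_norml /rho => /andP[h1 h2]; split; lra.
Qed.

Lemma rho_ge0 : 0 <= rho p q r t.
Proof. by have [h _] := rho_ge_diag; exact: le_trans h. Qed.

(** To the right of both diagonal entries the characteristic polynomial is nonnegative only from its
    larger root on. *)
Lemma rho_le (y : R) : p <= y -> t <= y -> q * r <= (y - p) * (y - t) ->
  rho p q r t <= y.
Proof.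
move=> py ty qr; rewrite /rho ler_pdivrMr //.
suff : Num.sqrt ((p - t) ^+ 2 + 4 * (q * r)) <= 2 * y - p - t by lra.
have h : 0 <= 2 * y - p - t by lra.
rewrite -[leRHS](ger0_norm h) -sqrtr_sqr ler_sqrt ?sqr_ge0 //.
(* The identity behind this is (2y - p - t)^2 - (p - t)^2 = 4 (y - p)(y - t). *)
nra.
Qed.

(** The discriminant is nonnegative, so by Vieta's formulas the polynomial splits over the complex
    numbers into its two real roots; p + t >= 0 makes the larger one dominate in modulus. *)
Lemma complex_root_norm (z : R[i]) :
  (z - toC p) * (z - toC t) = toC (q * r) -> ComplexField.Normc.normc z <= rho p q r t.
Proof.
have := sqr_sqrtr disc_ge0; rewrite /rho.
have := sqrtr_ge0 ((p - t) ^+ 2 + 4 * (q * r)).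
set d := Num.sqrt _ => d0 d2.
have h : `|p - t| <= d.
  by rewrite -sqrtr_sqr ler_sqrt // lerDl !mulr_ge0.
have zd (w : R[i]) : (w - toC p) * (w - toC t) - toC (q * r) =
   (w - toC ((p + t + d) / 2)) * (w - toC ((p + t - d) / 2)).
  have e : ((p + t + d) / 2) * ((p + t - d) / 2) = p * t - q * r.
    have -> : ((p + t + d) / 2) * ((p + t - d) / 2) = ((p + t) ^+ 2 - d ^+ 2) / 4 by field.
    by rewrite d2; field.
  have e2 : ((p + t + d) / 2) + ((p + t - d) / 2) = p + t by field.
  move: e e2; set x1 := _ / 2; set x2 := _ / 2 => e e2.
  have e' : toC x1 * toC x2 = toC p * toC t - toC (q * r) by rewrite -!rmorphM /= -rmorphB /= e.
  have e2' : toC x1 + toC x2 = toC p + toC t by rewrite -!rmorphD /= e2.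
  have -> : (w - toC x1) * (w - toC x2) = w ^+ 2 - (toC x1 + toC x2) * w + toC x1 * toC x2 by ring.
  rewrite e' e2'; ring.
move/eqP; rewrite -subr_eq0 zd mulf_eq0 !subr_eq0 => /orP[] /eqP ->.
  rewrite /= expr0n addr0 sqrtr_sqr ger0_norm // divr_ge0 // addr_ge0 // addr_ge0 //.
rewrite /= expr0n addr0 sqrtr_sqr normrM (ger0_norm (_ : 0 <= 2^-1)) //.
rewrite ler_pM2r // ler_norml; apply/andP; split.
  by move: p0 t0 d0; lra.
by move: d0; lra.
Qed.

Lemma spectral_radius_mx2 : spectral_radius (mx2 p q r t) = rho p q r t.
Proof.
have eigE z : eigenvalue (map_mx (real_complex R) (mx2 p q r t)) z =
    ((z - toC p) * (z - toC t) == toC (q * r)).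
  rewrite eigenvalue_root_char rootE /char_poly det_mx2 !mxE /= !hornerE.
  by rewrite rmorphM /= mulrNN subr_eq0.
have ubE : ubound [set ComplexField.Normc.normc z | z in
         [set z : R[i] | eigenvalue (map_mx (real_complex R) (mx2 p q r t)) z]]
   (rho p q r t).
  by move=> _ [z /= + <-]; rewrite eigE => /eqP; exact: complex_root_norm.
have inE' : [set ComplexField.Normc.normc z | z in
         [set z : R[i] | eigenvalue (map_mx (real_complex R) (mx2 p q r t)) z]]
   (rho p q r t).
  exists (toC (rho p q r t)) => /=.
    by rewrite eigE -!rmorphB -rmorphM rho_root.
  by rewrite expr0n addr0 sqrtr_sqr ger0_norm // rho_ge0.
apply/le_anti/andP; split; first by apply: ge_sup => //; exists (rho p q r t).
by apply: ub_le_sup => //; exists (rho p q r t).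
Qed.

End PerronRoot.

(** Apply [rho_le] at l * rho: its gaps to p' and t' are at least l times the gaps of rho to p and
    t, whose product is q r. *)
Lemma rho_mono (R : realType) (l p q r t p' q' r' t' : R) : 0 <= l ->
  0 <= p -> 0 <= q -> 0 <= r -> 0 <= t ->
  0 <= p' <= l * p -> 0 <= q' <= l * q -> 0 <= r' <= l * r -> 0 <= t' <= l * t ->
  rho p' q' r' t' <= l * rho p q r t.
Proof.
move=> l0 p0 q0 r0 t0 /andP[p'0 pp] /andP[q'0 qq] /andP[r'0 rr] /andP[t'0 tt].
have [h1 h2] := rho_ge_diag p t q0 r0.
have /(congr1 ( *%R (l ^+ 2))) h3 := rho_root p t q0 r0.
have lp := ler_wpM2l l0 h1; have lt := ler_wpM2l l0 h2.
apply: rho_le => //; [exact: le_trans lp|exact: le_trans lt|].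
apply: (@le_trans _ _ (l ^+ 2 * (q * r))).
  by rewrite expr2 mulrACA; exact: ler_pM.
rewrite -h3.
have -> (x : R) : l ^+ 2 * ((x - p) * (x - t)) = (l * x - l * p) * (l * x - l * t) by ring.
by apply: ler_pM; rewrite ?subr_ge0 // lerD2l lerN2.
Qed.

(** Serves s = 0 and s >= 2, where the two exponents coincide and the weights become symmetric. *)
Lemma rho_circulant (R : realType) (p q : R) : 0 <= q -> rho p q q p = p + q.
Proof.
move=> q0; rewrite /rho subrr expr0n add0r.
have -> : 4 * (q * q) = (2 * q) ^+ 2 :> R by ring.
by rewrite sqrtr_sqr ger0_norm ?mulr_ge0 //; field.
Qed.

(** * Singular values of generalized permutation matrices *)

Definition gperm (R : realType) (e : bool) (x y : R) : 'M[R]_2 :=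
  if e then mx2 0 x y 0 else mx2 x 0 0 y.

(** Distinct roots repeated by multiplicity are a rearrangement of [s] grouped by equal values, and
    sorting forgets the arrangement. *)
Lemma singular_values_split (R : realType) (n : nat) (A : 'M[R]_n) (s : seq R) :
  char_poly (A^T *m A) = \prod_(x <- s) ('X - x%:P) ->
  singular_values A = sort >=%O (map Num.sqrt s).
Proof.
move=> ch; rewrite /singular_values ch.
set p := \prod_(x <- s) ('X - x%:P).
have p0 : p != 0 by rewrite monic_neq0 // monic_prod_XsubC.
apply/perm_sortP.
- by move=> x y; exact: le_total.
- by move=> x y z xy yz; exact: le_trans yz xy.
- by move=> x y /le_anti.
rewrite -(permPr (perm_map _ (perm_count_undup s))).
have -> : [seq nseq (mup x p) (Num.sqrt x) | x <- rootsR p] =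
  [seq map Num.sqrt (nseq (count_mem x s) x) | x <- rootsR p].
  by apply: eq_map => x; rewrite map_nseq mu_prod_XsubC.
rewrite map_flatten -map_comp; apply/perm_flatten/perm_map.
apply: uniq_perm; [exact: uniq_roots|exact: undup_uniq|] => x.
by rewrite -roots_on_rootsR // mem_undup -root_prod_XsubC.
Qed.

Lemma singular_values_gperm (R : realType) (e : bool) (x y : R) :
  singular_values (gperm e x y) =
  [:: Num.max `|x| `|y|; Num.min `|x| `|y|].
Proof.
(* [A^T *m A] is diagonal with the squared entries, in an order that depends on [e]. *)
have [u [v [uv ->]]] : exists u v : R, ((u = x /\ v = y) \/ (u = y /\ v = x)) /\
    singular_values (gperm e x y) = sort >=%O [:: `|u|; `|v|].
  exists (if e then y else x), (if e then x else y); split; first by case: e; auto.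
  rewrite -!sqrtr_sqr.
  apply: (@singular_values_split _ _ _ [:: (if e then y else x) ^+ 2; (if e then x else y) ^+ 2]).
  rewrite char_poly_trig ?big_ord_recl ?big_ord0 ?big_cons ?big_nil.
    by case: e; rewrite !mxE !big_ord_recl !big_ord0 !mxE /= ?(mul0r, add0r, addr0, expr2).
  apply/is_trig_mxP => i j; rewrite !mxE !big_ord_recl !big_ord0 !mxE /=.
  by case: e; case: i j => [[|[|i]] Hi] [[|[|j]] Hj]; rewrite //= !mxE /= ?(mul0r, mulr0, add0r).
rewrite /sort /=.
by case: uv => -[-> ->]; case: (ltgtP `|x| `|y|) => //= ->.
Qed.

(** * Exponents and multiplicative weights *)

(* Over all three ranges of s, [phi^s(B) = alpha_1(B)^(c1 s) * alpha_2(B)^(c2 s)];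
   c1 and c2 are nondecreasing with sum s, so that raising s by h multiplies
   [wt s] by a factor between the extreme h-th powers of its arguments. *)
Definition c1 (R : realType) (s : R) : R :=
  if s <= 1 then s else if s <= 2 then 1 else s / 2.
Definition c2 (R : realType) (s : R) : R :=
  if s <= 1 then 0 else if s <= 2 then s - 1 else s / 2.
Definition wt (R : realType) (s x y : R) : R := x `^ c1 s * y `^ c2 s.

Lemma c1Dc2 (R : realType) (s : R) : c1 s + c2 s = s.
Proof. by rewrite /c1 /c2; do 2?case: ifP => _; lra. Qed.

Lemma c1_mono (R : realType) (s t : R) : s <= t -> c1 s <= c1 t.
Proof.
by rewrite /c1; case: (leP s 1); case: (leP t 1); case: (leP s 2); case: (leP t 2); lra.
Qed.

Lemma c2_mono (R : realType) (s t : R) : s <= t -> c2 s <= c2 t.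
Proof.
by rewrite /c2; case: (leP s 1); case: (leP t 1); case: (leP s 2); case: (leP t 2); lra.
Qed.

Lemma c2_le_c1 (R : realType) (s : R) : 0 <= s -> c2 s <= c1 s.
Proof. by rewrite /c1 /c2; case: (leP s 1); case: (leP s 2); lra. Qed.

Lemma wt_gt0 (R : realType) (s x y : R) : 0 < x -> 0 < y -> 0 < wt s x y.
Proof. by move=> x0 y0; rewrite mulr_gt0 // powR_gt0. Qed.

Lemma wtM (R : realType) (s x y x' y' : R) : 0 < x -> 0 < y -> 0 < x' -> 0 < y' ->
  wt s (x * x') (y * y') = wt s x y * wt s x' y'.
Proof. by move=> *; rewrite /wt !powRM 1?ltW // mulrACA. Qed.

Lemma powRD_pos (R : realType) (x s t : R) : 0 < x -> x `^ (s + t) = x `^ s * x `^ t.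
Proof. by move=> x0; rewrite powRD // (gt_eqF x0) implybT. Qed.

(** The exponents added to [u] and [v] are nonnegative and sum to [t - s], so both added powers can
    be bounded by powers of [Q]. *)
Lemma wt_scale_le (R : realType) (Q s t u v : R) : 0 < u <= Q -> 0 < v <= Q -> s <= t ->
  wt t u v <= Q `^ (t - s) * wt s u v.
Proof.
move=> /andP[u0 uQ] /andP[v0 vQ] st; have Q0 := lt_le_trans u0 uQ.
have d1 : 0 <= c1 t - c1 s by rewrite subr_ge0 c1_mono.
have d2 : 0 <= c2 t - c2 s by rewrite subr_ge0 c2_mono.
have -> : t - s = (c1 t - c1 s) + (c2 t - c2 s) by rewrite -{1}(c1Dc2 t) -{1}(c1Dc2 s); ring.
rewrite /wt -[c1 t](subrK (c1 s)) -[c2 t](subrK (c2 s)) !addrK.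
move: (c1 t - c1 s) (c2 t - c2 s) d1 d2 => a b a0 b0.
rewrite !powRD_pos // mulrACA ler_pM2r ?mulr_gt0 ?powR_gt0 //.
by apply: ler_pM; rewrite ?powR_ge0 // ge0_ler_powR // nnegrE ltW.
Qed.

Lemma wt_scale_ge (R : realType) (m s t u v : R) : 0 < m -> m <= u -> m <= v -> s <= t ->
  m `^ (t - s) * wt s u v <= wt t u v.
Proof.
move=> m0 mu mv st; have u0 := lt_le_trans m0 mu; have v0 := lt_le_trans m0 mv.
have d1 : 0 <= c1 t - c1 s by rewrite subr_ge0 c1_mono.
have d2 : 0 <= c2 t - c2 s by rewrite subr_ge0 c2_mono.
have -> : t - s = (c1 t - c1 s) + (c2 t - c2 s) by rewrite -{1}(c1Dc2 t) -{1}(c1Dc2 s); ring.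
rewrite /wt -[c1 t](subrK (c1 s)) -[c2 t](subrK (c2 s)) !addrK.
move: (c1 t - c1 s) (c2 t - c2 s) d1 d2 => a b a0 b0.
rewrite !powRD_pos // [leRHS]mulrACA ler_pM2r ?mulr_gt0 ?powR_gt0 //.
by apply: ler_pM; rewrite ?powR_ge0 // ge0_ler_powR // nnegrE ltW.
Qed.

(** Cancelling the common factor (x y)^(c2 s) leaves a comparison of powers with exponent c1 s - c2
    s >= 0. *)
Lemma wt_swap_le (R : realType) (s x y : R) : 0 <= s -> 0 < y -> y <= x ->
  wt s y x <= wt s x y.
Proof.
move=> s0 y0 yx; have x0 := lt_le_trans y0 yx.
have : 0 <= c1 s - c2 s by rewrite subr_ge0 c2_le_c1.
rewrite /wt -[c1 s](subrK (c2 s)) addrK; move: (_ - _) => c c0.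
rewrite !powRD_pos // -!mulrA [y `^ c2 s * _]mulrC.
rewrite ler_pM2r ?mulr_gt0 ?powR_gt0 //.
by apply: ge0_ler_powR; rewrite ?nnegrE // ltW.
Qed.

(** * The singular value function of a generalized permutation matrix *)

Lemma det_gperm (R : realType) (e : bool) (x y : R) :
  `|\det (gperm e x y)| = `|x| * `|y|.
Proof.
by case: e; rewrite det_mx2 !mxE /= ?(mul0r, sub0r, mulr0, subr0) ?normrN normrM.
Qed.

Lemma singular_value_function_gperm (R : realType) (s : R) (e : bool) (x y : R) :
  0 <= s -> x != 0 -> y != 0 ->
  singular_value_function s (gperm e x y) =
  wt s (Num.max `|x| `|y|) (Num.min `|x| `|y|).
Proof.
move=> s0 x0 y0; rewrite /singular_value_function.
have mM : Num.max `|x| `|y| * Num.min `|x| `|y| = `|x| * `|y|.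
  by case: leP => // _; rewrite mulrC.
have M0 : 0 < Num.max `|x| `|y| by rewrite lt_max normr_gt0 x0.
have m0 : 0 < Num.min `|x| `|y| by rewrite lt_min !normr_gt0 x0.
case: (leP s 2) => s2; last first.
  rewrite det_gperm -mM powRM 1?ltW // /wt /c1 /c2.
  by rewrite !leNgt s2 (lt_trans _ s2) //= ltrDl.
rewrite /singular_value singular_values_gperm /wt /c1 /c2 s2.
set M := Num.max _ _; set m := Num.min _ _.
have [s1|s1|->] := ltgtP s 1.
- rewrite (_ : Num.truncn s = 0%N); last by apply: truncn_def; rewrite s0.
  rewrite big_geq // mul1r subr0 powRr0 mulr1; congr (_ `^ _).
  (* At s = 0 the index is 0 and its predecessor is again 0, so the largest singular value is still
     the one read. *)
  have [->|sn0] := eqVneq s 0; first by rewrite ceil0.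
  by rewrite (_ : Num.ceil s = 1) //; apply: ceil_def; rewrite subrr lt_neqAle eq_sym sn0 s0 ltW.
(* The floor jumps at s = 2, where the second singular value moves from the fractional factor into
   the product. *)
- have [se2|->] : s < 2 \/ s = 2 by move: s2; rewrite le_eqVlt => /orP[/eqP|]; auto.
    rewrite (_ : Num.truncn s = 1%N); last by apply: truncn_def; rewrite ltW.
    rewrite big_nat1 /= powRr1 1?ltW //; congr (_ * _ `^ _).
    by rewrite (_ : Num.ceil s = 2) //; apply: ceil_def; rewrite s1.
  rewrite (_ : Num.truncn 2 = 2%N); last by apply: truncn_def; rewrite lexx ltr_nat.
  rewrite big_nat_recl // big_nat1 /= subrr powRr0 mulr1.
  by rewrite (_ : 2 - 1 = 1) ?powRr1 1?ltW //; ring.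
rewrite (_ : Num.truncn 1 = 1%N); last by apply: truncn_def; rewrite lexx ltr1n.
by rewrite big_nat1 /= subrr !powRr0 powRr1 // ltW.
Qed.

(** A maximum of two positive numbers lies between half their sum and their sum. The sum, unlike the
    maximum, can be computed by matrix algebra. *)
Lemma singular_value_function_gperm_bounds (R : realType) (s : R) (e : bool) (x y : R) :
  0 <= s -> x != 0 -> y != 0 ->
  let S := wt s `|x| `|y| + wt s `|y| `|x| in
  S / 2 <= singular_value_function s (gperm e x y) <= S.
Proof.
move=> s0 x0 y0 /=; rewrite singular_value_function_gperm //.
have X : 0 < `|x| by rewrite normr_gt0.
have Y : 0 < `|y| by rewrite normr_gt0.
have p1 := wt_gt0 s X Y; have p2 := wt_gt0 s Y X.
have [xy|yx] := leP `|x| `|y|.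
  by have := wt_swap_le s0 X xy; move: p1 p2; lra.
by have := wt_swap_le s0 Y (ltW yx); move: p1 p2; lra.
Qed.

(** * Sums of products over words *)

Lemma mulmx_gperm (R : realType) (e e' : bool) (x y x' y' : R) :
  gperm e x y *m gperm e' x' y' =
  gperm (e (+) e') (x * if e then y' else x') (y * if e then x' else y').
Proof.
apply/matrixP => -[[|[|i]] Hi] [[|[|j]] Hj] //;
  rewrite !mxE !big_ord_recl !big_ord0;
  by case: e; case: e'; rewrite !mxE /= ?(mul0r, mulr0, add0r, addr0).
Qed.

(** Used as a size for nonnegative matrices: being linear, it commutes with the sum over words. *)
Definition entry_sum (R : realType) (B : 'M[R]_2) : R := \sum_i \sum_j B i j.

Lemma entry_sum_gperm (R : realType) (e : bool) (x y : R) :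
  entry_sum (gperm e x y) = x + y.
Proof.
rewrite /entry_sum !big_ord_recl !big_ord0.
by case: e; rewrite !mxE /= ?(add0r, addr0).
Qed.

Lemma entry_sum_sum (R : realType) (I : finType) (F : I -> 'M[R]_2) :
  entry_sum (\sum_i F i) = \sum_i entry_sum (F i).
Proof.
rewrite /entry_sum [RHS]exchange_big; apply: eq_bigr => i _ /=.
by rewrite [RHS]exchange_big; apply: eq_bigr => j _ /=; exact: summxE.
Qed.

Lemma sum_word_product (R : realType) (N n : nat) (W : 'I_N -> 'M[R]_2) :
  \sum_(w : n.-tuple 'I_N) word_product W w = (\sum_i W i) ^+ n.
Proof.
have wE m (w : m.-tuple 'I_N) : word_product W w = \prod_(i <- rev w) W i by [].
elim: n => [|n IH].
  rewrite (bigD1 [tuple]) //= big1 ?addr0 => [|w]; last by rewrite tuple0.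
  by rewrite /word_product big_nil expr0.
(* [word_product] reverses the word, so a letter put in front becomes the rightmost factor; hence
   the power is split on the right. *)
rewrite exprSr -IH.
rewrite (reindex (fun p : 'I_N * n.-tuple 'I_N => [tuple of p.1 :: p.2])) /=; last first.
  exists (fun w : n.+1.-tuple 'I_N => (thead w, [tuple of behead w])) => [[i w] _|w _] /=.
    by rewrite theadE; congr pair; apply/val_inj.
  by rewrite -tuple_eta.
rewrite mulr_suml -(pair_bigA _ (fun i (w : n.-tuple 'I_N) => word_product W [tuple of i :: w])).
rewrite exchange_big; apply: eq_bigr => w _; rewrite mulr_sumr; apply: eq_bigr => i _.
by rewrite !wE rev_cons big_rcons.
Qed.

(** * Growth of the powers of a nonnegative matrix *)

Section Growth.
Variables (R : realType) (p q r t : R).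
Hypotheses (p0 : 0 <= p) (t0 : 0 <= t).
Hypothesis qr : (q = 0 /\ r = 0) \/ (0 < q /\ 0 < r).
Variables X Y : nat -> R.
Hypotheses (X0 : X 0%N = 1) (Y0 : Y 0%N = 1).
Hypothesis XS : forall n, X n.+1 = X n * p + Y n * r.
Hypothesis YS : forall n, Y n.+1 = X n * q + Y n * t.

(** The row (X n, Y n) is (1, 1) times the n-th power of the matrix. Hypothesis [qr] excludes Jordan
    blocks, which would add a factor n. If q, r > 0, then (q, z - p) is a positive right eigenvector
    for the root z, and pairing with it gives an exact geometric sequence. *)
Lemma rho_growth : exists C : R * R, 0 < C.1 /\ 0 < C.2 /\
  forall n, C.1 * rho p q r t ^+ n <= X n + Y n <= C.2 * rho p q r t ^+ n.
Proof.
have [q0 r0] : 0 <= q /\ 0 <= r by case: qr => -[]; [move=> -> ->|move=> /ltW ? /ltW].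
have XY0 n : 0 <= X n /\ 0 <= Y n.
  elim: n => [|n [IX IY]]; first by rewrite X0 Y0.
  by rewrite XS YS; split; apply: addr_ge0; apply: mulr_ge0.
have := rho_root p t q0 r0; have := rho_ge_diag p t q0 r0.
have := rho_ge0 t p0 q0 r0.
move: (rho p q r t) => z z0 [pz tz] root_z.
case: qr => [[qe re]|[q1 r1]].
  have Xn n : X n = p ^+ n.
    by elim: n => [|n IH] //; rewrite XS IH re mulr0 addr0 exprSr.
  have Yn n : Y n = t ^+ n.
    by elim: n => [|n IH] //; rewrite YS IH qe mulr0 add0r exprSr.
  (* In the diagonal case z is the larger of p and t, so z^n <= p^n + t^n <= 2 z^n. *)
  exists (1, 2); split => //; split => // n; rewrite Xn Yn /=.
  have p1 := exprn_ge0 n p0; have t1 := exprn_ge0 n t0.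
  have h1 : p ^+ n <= z ^+ n by rewrite lerXn2r.
  have h2 : t ^+ n <= z ^+ n by rewrite lerXn2r.
  have : z = p \/ z = t.
    move/eqP: root_z; rewrite qe mul0r mulf_eq0 !subr_eq0.
    by move=> /orP[] /eqP; auto.
  by move: p1 t1 h1 h2 => + + + + [] zE; rewrite zE; lra.
have v0 : 0 < z - p.
  rewrite lt_neqAle subr_ge0 pz andbT; apply/eqP => zp.
  by move: root_z; rewrite -zp mul0r => /esym/eqP; rewrite mulf_eq0 !gt_eqF.
have inv n : X n * q + Y n * (z - p) = (q + (z - p)) * z ^+ n.
  elim: n => [|n IH]; first by rewrite X0 Y0 !mul1r mulr1.
  rewrite exprSr mulrA -IH XS YS.
  have e : Y n * (r * q) = Y n * ((z - p) * (z - t)) by rewrite root_z (mulrC r).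
  transitivity (X n * q * z + (Y n * (r * q) + Y n * t * (z - p))); first by ring.
  by rewrite e; ring.
have a0 : 0 < q + (z - p) by exact: addr_gt0.
have M0 : 0 < Num.max q (z - p) by rewrite lt_max q1.
have m0 : 0 < Num.min q (z - p) by rewrite lt_min q1.
(* Replacing both eigenvector coordinates in [inv] by their maximum or their minimum turns the left
   side into a multiple of X n + Y n. *)
exists ((q + (z - p)) / Num.max q (z - p), (q + (z - p)) / Num.min q (z - p)) => /=.
split; first exact: divr_gt0.
split; first exact: divr_gt0.
move=> n.
have [x0 y0] := XY0 n.
rewrite mulrAC ler_pdivrMr // mulrAC ler_pdivlMr // -inv !mulrDl; apply/andP; split.
  by apply: lerD; apply: ler_wpM2l => //; rewrite le_max lexx ?orbT.
by apply: lerD; apply: ler_wpM2l => //; rewrite ge_min lexx ?orbT.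
Qed.

End Growth.

Lemma entry_sum_exp_growth (R : realType) (p q r t : R) : 0 <= p -> 0 <= t ->
  (q = 0 /\ r = 0) \/ (0 < q /\ 0 < r) ->
  exists C : R * R, 0 < C.1 /\ 0 < C.2 /\
  forall n, C.1 * rho p q r t ^+ n <= entry_sum (mx2 p q r t ^+ n)
    <= C.2 * rho p q r t ^+ n.
Proof.
move=> p0 t0 qr.
(* Column sums, which obey the required recurrence under multiplication on the right. *)
pose X n := (mx2 p q r t ^+ n) ord0 ord0 + (mx2 p q r t ^+ n) ord_max ord0.
pose Y n := (mx2 p q r t ^+ n) ord0 ord_max + (mx2 p q r t ^+ n) ord_max ord_max.
have l0 : lift ord0 ord0 = ord_max :> 'I_2 by apply/val_inj.
have XYE n : entry_sum (mx2 p q r t ^+ n) = X n + Y n.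
  by rewrite /entry_sum !big_ord_recl !big_ord0 !addr0 /X /Y !l0 addrACA.
have [||||C HC] := @rho_growth R p q r t p0 t0 qr X Y.
- by rewrite /X expr0 !mxE /= addr0.
- by rewrite /Y expr0 !mxE /= add0r.
- move=> n; rewrite /X exprSr !mxE !big_ord_recl !big_ord0 !addr0 !l0 !mxE /=.
  by rewrite /X /Y; ring.
- move=> n; rewrite /Y exprSr !mxE !big_ord_recl !big_ord0 !addr0 !l0 !mxE /=.
  by rewrite /X /Y; ring.
by exists C; case: HC => ? [? h]; split => //; split => // n; rewrite XYE.
Qed.

(** * The pressure as the logarithm of a spectral radius *)

Section GeneralizedPermutations.
Variables (R : realType) (N : nat) (e : 'I_N -> bool) (x y : 'I_N -> R).
Hypotheses (x0 : forall i, 0 < `|x i|) (y0 : forall i, 0 < `|y i|).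

Definition weight_mx (s : R) (i : 'I_N) : 'M[R]_2 :=
  gperm (e i) (wt s `|x i| `|y i|) (wt s `|y i| `|x i|).

(** By [sum_weight_mx] and [spectral_radius_mx2] this is the spectral radius of the sum of the
    weight matrices. *)
Definition growth_rate (s : R) : R :=
  rho (\sum_(i | ~~ e i) wt s `|x i| `|y i|) (\sum_(i | e i) wt s `|x i| `|y i|)
      (\sum_(i | e i) wt s `|y i| `|x i|) (\sum_(i | ~~ e i) wt s `|y i| `|x i|).

Lemma sum_weight_mx (s : R) : \sum_i weight_mx s i =
  mx2 (\sum_(i | ~~ e i) wt s `|x i| `|y i|) (\sum_(i | e i) wt s `|x i| `|y i|)
      (\sum_(i | e i) wt s `|y i| `|x i|) (\sum_(i | ~~ e i) wt s `|y i| `|x i|).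
Proof.
apply/matrixP => -[[|[|i]] Hi] [[|[|j]] Hj] //;
  rewrite summxE !mxE /= [RHS]big_mkcond; apply: eq_bigr => l _;
  by rewrite /weight_mx /gperm; case: (e l); rewrite !mxE.
Qed.

(** Products of generalized permutations only permute and multiply entries, and [wt] is
    multiplicative, so taking weights commutes with word products. *)
Lemma word_product_gperm (s : R) (n : nat) (w : n.-tuple 'I_N) :
  exists (f : bool) (u v : R), [/\ u != 0, v != 0,
    word_product (fun i => gperm (e i) (x i) (y i)) w = gperm f u v
  & word_product (weight_mx s) w = gperm f (wt s `|u| `|v|) (wt s `|v| `|u|)].
Proof.
rewrite /word_product; elim: (rev w) => [|i l [f [u [v [u0 v0 IA IW]]]]].
  exists false, 1, 1; rewrite !big_nil !oner_eq0 normr1 /wt !powR1 !mulr1; split => //;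
    by apply/matrixP => -[[|[|i]] Hi] [[|[|j]] Hj]; rewrite ?mxE.
rewrite !big_cons IA IW /weight_mx !mulmx_gperm.
exists (e i (+) f), (x i * if e i then v else u), (y i * if e i then u else v).
have nx : x i != 0 by rewrite -normr_gt0.
have ny : y i != 0 by rewrite -normr_gt0.
by case: (e i); split => //; rewrite ?mulf_neq0 // !normrM !wtM // ?normr_gt0.
Qed.

Lemma sum_singular_value_function_bounds (s : R) (n : nat) : 0 <= s ->
  let S := entry_sum ((\sum_i weight_mx s i) ^+ n) in
  S / 2 <= \sum_(w : n.-tuple 'I_N) singular_value_function s
             (word_product (fun i => gperm (e i) (x i) (y i)) w) <= S.
Proof.
move=> s0; rewrite /= -sum_word_product entry_sum_sum mulr_suml.
have H (w : n.-tuple 'I_N) : entry_sum (word_product (weight_mx s) w) / 2 <=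
    singular_value_function s (word_product (fun i => gperm (e i) (x i) (y i)) w)
    <= entry_sum (word_product (weight_mx s) w).
  have [f [u [v [u0 v0 -> ->]]]] := word_product_gperm s w.
  by rewrite entry_sum_gperm; exact: singular_value_function_gperm_bounds.
by apply/andP; split; apply: ler_sum => w _; case/andP: (H w).
Qed.

Let sum_wt_ge0 (s : R) (P : pred 'I_N) :
  0 <= \sum_(i | P i) wt s `|x i| `|y i| /\ 0 <= \sum_(i | P i) wt s `|y i| `|x i|.
Proof. by split; apply: sumr_ge0 => i _; rewrite ltW // wt_gt0. Qed.

Let sum_wt_gt0 (s : R) (P : pred 'I_N) (i : 'I_N) : P i ->
  0 < \sum_(i | P i) wt s `|x i| `|y i| /\ 0 < \sum_(i | P i) wt s `|y i| `|x i|.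
Proof.
move=> Pi; rewrite !(bigD1 i Pi) /=; split.
  by rewrite ltr_wpDr ?wt_gt0 //; case: (sum_wt_ge0 s (fun j => P j && (j != i))).
by rewrite ltr_wpDr ?wt_gt0 //; case: (sum_wt_ge0 s (fun j => P j && (j != i))).
Qed.

Lemma growth_rate_gt0 (s : R) : (0 < N)%N -> 0 < growth_rate s.
Proof.
move=> N0; pose i := Ordinal N0; rewrite /growth_rate.
have [p0 t0] := sum_wt_ge0 s (fun i => ~~ e i).
have [q0 r0] := sum_wt_ge0 s e.
have [h1 h2] := rho_ge_diag (\sum_(i | ~~ e i) wt s `|x i| `|y i|)
                  (\sum_(i | ~~ e i) wt s `|y i| `|x i|) q0 r0.
have [ei|ei] := boolP (e i); last first.
  by case: (sum_wt_gt0 s (P := fun i => ~~ e i) ei) => p1 _; exact: lt_le_trans h1.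
have [q1 r1] := sum_wt_gt0 s ei.
(* With an antidiagonal letter both off-diagonal sums are positive; if rho were 0, the first
   diagonal sum would vanish and [rho_root] would force q r = 0. *)
rewrite lt_neqAle rho_ge0 // andbT eq_sym; apply/eqP => z.
have := rho_root (\sum_(i | ~~ e i) wt s `|x i| `|y i|)
                  (\sum_(i | ~~ e i) wt s `|y i| `|x i|) q0 r0.
move: h1 h2; rewrite z => h1 h2.
have -> : \sum_(i | ~~ e i) wt s `|x i| `|y i| = 0 by apply/le_anti; rewrite h1.
by rewrite subrr mul0r => /esym/eqP; rewrite mulf_eq0 !gt_eqF.
Qed.

Lemma sum_singular_value_function_growth (s : R) : 0 <= s ->
  exists C : R * R, 0 < C.1 /\ 0 < C.2 /\
  forall n, C.1 * growth_rate s ^+ n <=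
    \sum_(w : n.-tuple 'I_N) singular_value_function s
             (word_product (fun i => gperm (e i) (x i) (y i)) w)
    <= C.2 * growth_rate s ^+ n.
Proof.
move=> s0.
have [p0 t0] := sum_wt_ge0 s (fun i => ~~ e i).
have [|C [C1 [C2 HC]]] := @entry_sum_exp_growth R _ (\sum_(i | e i) wt s `|x i| `|y i|)
  (\sum_(i | e i) wt s `|y i| `|x i|) _ p0 t0.
  (* Both off-diagonal sums run over the same letters, so they vanish together or are both
     positive. *)
  have [i ei|ne] := pickP e; [right|left]; first exact: sum_wt_gt0 ei.
  by rewrite !big_pred0.
exists (C.1 / 2, C.2); split; first exact: divr_gt0.
split=> // n; have := sum_singular_value_function_bounds n s0.
have := HC n; rewrite -sum_weight_mx -/(growth_rate s) /= => /andP[h1 h2] /andP[h3 h4].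
apply/andP; split; last exact: le_trans h2.
by apply: le_trans h3; rewrite mulrAC ler_pM2r.
Qed.

Lemma pressure_gperm (s : R) : (0 < N)%N -> 0 <= s ->
  pressure_is (fun i => gperm (e i) (x i) (y i)) s (ln (growth_rate s))%:E.
Proof.
move=> N0 s0; have G0 := growth_rate_gt0 s N0.
have [[C1 C2] /= [C10 [C20 HC]]] := sum_singular_value_function_growth s0.
(* The shift discards n = 0, where the inverse of n is 0 by convention. *)
rewrite /pressure_is -cvg_shiftS.
pose S n := \sum_(w : n.-tuple 'I_N) singular_value_function s
  (word_product (fun i => gperm (e i) (x i) (y i)) w).
have S0 n : 0 < S n.
  by have /andP[h _] := HC n; apply: lt_le_trans h; rewrite mulr_gt0 // exprn_gt0.
have -> : [sequence (n.+1%:R^-1)%:E * lne (\sum_(w : n.+1.-tuple 'I_N)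
      singular_value_function s (word_product (fun i => gperm (e i) (x i) (y i)) w))%:E]_n%E
   = EFin \o (fun n => n.+1%:R^-1 * ln (S n.+1)).
  by apply/funext => n; rewrite /comp EFinM; congr (_ * _)%E; exact: lne_EFin (S0 _).
apply: cvg_EFin; first exact: nearW.
(* A multiplicative constant C adds only ln C / n, which vanishes in the limit. *)
have lim (C : R) : (fun n => harmonic n * C + ln (growth_rate s)) @ \oo --> ln (growth_rate s).
  rewrite -[X in _ --> X]add0r -(mul0r C); apply: cvgD; last exact: cvg_cst.
  by apply: cvgMl; exact: cvg_harmonic.
apply: (squeeze_cvgr _ (lim (ln C1)) (lim (ln C2))).
apply: nearW => n; rewrite /= /harmonic.
have n0 : 0 < n.+1%:R :> R by rewrite ltr0n.
have E (C : R) : 0 < C -> n.+1%:R^-1 * ln C + ln (growth_rate s) =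
    n.+1%:R^-1 * ln (C * growth_rate s ^+ n.+1).
  move=> C0; rewrite lnM ?posrE ?exprn_gt0 // lnXn // mulrDr; congr (_ + _).
  by rewrite -[ln _ *+ _]mulr_natl mulKf // gt_eqF.
have /andP[h1 h2] := HC n.+1.
by rewrite !E // !ler_pM2l ?invr_gt0 // !ler_ln ?posrE ?mulr_gt0 ?exprn_gt0 // h1.
Qed.

Lemma growth_rate_scale (l s t : R) : 0 <= l ->
  (forall i, wt t `|x i| `|y i| <= l * wt s `|x i| `|y i|) ->
  (forall i, wt t `|y i| `|x i| <= l * wt s `|y i| `|x i|) ->
  growth_rate t <= l * growth_rate s.
Proof.
move=> l0 h1 h2.
have H P : 0 <= \sum_(i | P i) wt t `|x i| `|y i| <= l * \sum_(i | P i) wt s `|x i| `|y i|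
   /\ 0 <= \sum_(i | P i) wt t `|y i| `|x i| <= l * \sum_(i | P i) wt s `|y i| `|x i|.
  by have [-> ->] := sum_wt_ge0 t P; rewrite !mulr_sumr; split; apply: ler_sum.
have [H1 H2] := H e; have [H3 H4] := H (fun i => ~~ e i).
have [p0 t0] := sum_wt_ge0 s (fun i => ~~ e i).
have [q0 r0] := sum_wt_ge0 s e.
exact: rho_mono.
Qed.

Lemma growth_rate_bounds (m Q s t : R) : 0 < m ->
  (forall i, m <= `|x i| <= Q) -> (forall i, m <= `|y i| <= Q) -> s <= t ->
  m `^ (t - s) * growth_rate s <= growth_rate t <= Q `^ (t - s) * growth_rate s.
Proof.
move=> m0 hx hy st; apply/andP; split; last first.
  apply: growth_rate_scale => [|i|i]; first exact: powR_ge0.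
    by apply: wt_scale_le => //; rewrite ?x0 ?y0; case/andP: (hx i); case/andP: (hy i).
  by apply: wt_scale_le => //; rewrite ?x0 ?y0; case/andP: (hx i); case/andP: (hy i).
have M0 : 0 < m `^ (t - s) by rewrite powR_gt0.
(* The lower bound is the scaling lemma with [s] and [t] exchanged and the inverse factor. *)
rewrite -ler_pdivlMl //; apply: growth_rate_scale => [|i|i].
- by rewrite invr_ge0 ltW.
- by rewrite ler_pdivlMl // wt_scale_ge //; case/andP: (hx i); case/andP: (hy i).
- by rewrite ler_pdivlMl // wt_scale_ge //; case/andP: (hx i); case/andP: (hy i).
Qed.

(** At exponent 0 all weights are 1, so the diagonal entries both count the diagonal letters and the
    off-diagonal ones the antidiagonal letters. *)
Lemma growth_rate0 : growth_rate 0 = N%:R.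
Proof.
have c10 : c1 0 = 0 :> R by rewrite /c1 ler01.
have c20 : c2 0 = 0 :> R by rewrite /c2 ler01.
rewrite /growth_rate; under eq_bigr do rewrite /wt c10 c20 !powRr0 mulr1.
under [X in rho _ X]eq_bigr do rewrite /wt c10 c20 !powRr0 mulr1.
under [X in rho _ _ X]eq_bigr do rewrite /wt c10 c20 !powRr0 mulr1.
under [X in rho _ _ _ X]eq_bigr do rewrite /wt c10 c20 !powRr0 mulr1.
rewrite rho_circulant ?sumr_ge0 //.
rewrite -[N in RHS]card_ord -sumr_const [RHS](bigID e) /= addrC.
by congr (_ + _); apply: eq_bigl.
Qed.

End GeneralizedPermutations.

(** * Existence and uniqueness of the root *)

Lemma lipschitz_decreasing_root (R : realType) (h : R -> R) (k K : R) :
  0 < k -> 0 < h 0 ->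
  (forall s t, s <= t -> k * (t - s) <= h s - h t <= K * (t - s)) ->
  exists s, 0 < s /\ forall t, h t = 0 <-> t = s.
Proof.
move=> k0 h0 H.
have K0 : 0 < K.
  by have /andP[a b] := H 0 1 ler01; move: a b; rewrite !subr0 !mulr1; lra.
(* The upper Lipschitz bound gives continuity. *)
have cont : continuous h.
  move=> s; apply/cvgrPdist_lt => eps e0; near=> t.
  have st : `|s - t| < eps / K.
    by near: t; apply/nbhs_ballP; exists (eps / K) => //=; exact: divr_gt0.
  rewrite ltr_pdivlMr // mulrC in st; apply: le_lt_trans st.
  case: (leP s t) => [le_st|/ltW le_ts].
    have /andP[h1 h2] := H s t le_st.
    rewrite ger0_norm; last by apply: le_trans h1; rewrite mulr_ge0 ?subr_ge0 // ltW.
    by rewrite distrC ger0_norm ?subr_ge0.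
  have /andP[h1 h2] := H t s le_ts.
  rewrite distrC ger0_norm; last by apply: le_trans h1; rewrite mulr_ge0 ?subr_ge0 // ltW.
  by rewrite ger0_norm ?subr_ge0.
(* Falling with slope at least k, h is nonpositive at h 0 / k, which bounds the interval for the
   intermediate value theorem. *)
have b0 : 0 <= h 0 / k by rewrite divr_ge0 // ltW.
have hb : h (h 0 / k) <= 0.
  have /andP[+ _] := H _ _ b0; rewrite subr0 mulrC divfK ?gt_eqF //; lra.
have [|s sI hs] := @IVT R h 0 (h 0 / k) 0 b0 (continuous_subspaceT cont).
  by rewrite ge_min le_max hb (ltW h0) orbT.
exists s; split.
  rewrite lt_neqAle; move: sI; rewrite in_itv /= => /andP[-> _]; rewrite andbT.
  by apply/eqP => s0; move: hs h0; rewrite -s0 => ->; rewrite ltxx.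
move=> t; split => [ht|-> //].
have [le_ts|lt_ts|//] := ltgtP t s.
  have /andP[+ _] := H _ _ (ltW le_ts); rewrite ht hs subrr.
  by rewrite leNgt mulr_gt0 // subr_gt0.
have /andP[+ _] := H _ _ (ltW lt_ts); rewrite ht hs subrr.
by rewrite leNgt mulr_gt0 // subr_gt0.
Unshelve. all: by end_near. Qed.

(** The images of the j-th basis vector and of 0 differ by column j, whose Euclidean norm is thus at
    most q and dominates each entry. *)
Lemma affine_contraction_entry_lt1 (R : realType) (n : nat)
    (T : 'cV[R]_n -> 'cV[R]_n) (A : 'M[R]_n) (v : 'cV[R]_n) (i j : 'I_n) :
  euclidean_contraction T -> (forall x, T x = A *m x + v) -> `|A i j| < 1.
Proof.
move=> [q /andP[q0 q1] hq] hT; apply: le_lt_trans q1.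
have := hq (delta_mx j ord0) 0.
rewrite !hT mulmx0 add0r addrK subr0 -colE.
have -> : euclidean_norm (delta_mx j ord0 : 'cV[R]_n) = 1.
  rewrite /euclidean_norm (bigD1 j) //= big1 => [|l lj]; rewrite !mxE.
    by rewrite !eqxx expr1n addr0 sqrtr1.
  by rewrite (negPf lj) expr0n.
rewrite mulr1; apply: le_trans.
rewrite /euclidean_norm (bigD1 i) //= -sqrtr_sqr ler_sqrt.
  by rewrite !mxE lerDl sumr_ge0 // => l _; exact: sqr_ge0.
by apply: addr_ge0; [exact: sqr_ge0|apply: sumr_ge0 => l _; exact: sqr_ge0].
Qed.

Lemma growth_rate_root (R : realType) (N : nat) (e : 'I_N -> bool) (x y : 'I_N -> R) :
  (2 <= N)%N -> (forall i, 0 < `|x i| < 1) -> (forall i, 0 < `|y i| < 1) ->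
  exists s, 0 < s /\ forall t, ln (growth_rate e x y t) = 0 <-> t = s.
Proof.
move=> N2 hx hy.
have x0 i : 0 < `|x i| by case/andP: (hx i).
have y0 i : 0 < `|y i| by case/andP: (hy i).
have G0 s : 0 < growth_rate e x y s by apply: growth_rate_gt0 => //; exact: ltnW.
(* The defaults 1/2 and 1 are compatible with 0 < Q < 1 and m > 0. *)
pose Q := \big[Num.max/2^-1]_i Num.max `|x i| `|y i|.
pose m := \big[Num.min/1]_i Num.min `|x i| `|y i|.
have Q0 : 0 < Q by apply: lt_le_trans (bigmax_ge_id _ _ _ _); rewrite invr_gt0.
have Q1 : Q < 1.
  apply: bigmax_lt => [|i _]; first by rewrite invf_lt1 // ltr1n.
  by rewrite gt_max; case/andP: (hx i) => _ ->; case/andP: (hy i).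
have m0 : 0 < m by apply: lt_bigmin => // i _; rewrite lt_min x0 y0.
have hx' i : m <= `|x i| <= Q.
  apply/andP; split.
    by apply: le_trans (bigmin_le _ i _) _; rewrite ge_min lexx.
  by apply: le_trans (le_bigmax _ _ i); rewrite le_max lexx.
have hy' i : m <= `|y i| <= Q.
  apply/andP; split.
    by apply: le_trans (bigmin_le _ i _) _; rewrite ge_min lexx orbT.
  by apply: le_trans (le_bigmax _ _ i); rewrite le_max lexx orbT.
(* Logarithms turn the factors Q^(t - s) and m^(t - s) into linear bounds with slopes - ln Q and -
   ln m; the value at 0 is ln N. *)
apply: (@lipschitz_decreasing_root _ _ (- ln Q) (- ln m)).
- by rewrite oppr_gt0 ln_lt0 // Q0.
- by rewrite growth_rate0 ln_gt0 // ltr1n.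
move=> s t st; have /andP[h1 h2] := growth_rate_bounds e x0 y0 m0 hx' hy' st.
have pos u : 0 < u -> 0 < u `^ (t - s) * growth_rate e x y s.
  by move=> u0; apply: mulr_gt0; [exact: powR_gt0|exact: G0].
have lnE u : 0 < u -> ln (u `^ (t - s) * growth_rate e x y s) =
    (t - s) * ln u + ln (growth_rate e x y s).
  by move=> u0; rewrite lnM ?posrE ?powR_gt0 ?ln_powR //; exact: G0.
rewrite -ler_ln ?posrE ?lnE in h1; try first [exact: m0|exact: pos m0|exact: G0].
rewrite -ler_ln ?posrE ?lnE in h2; try first [exact: Q0|exact: pos Q0|exact: G0].
by move: h1 h2; lra.
Qed.

(** * Matching the three conditions with growth rate 1 *)

Theorem corollary2 (R : realType) (N : nat) (hN : (2 <= N)%N)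
    (T : 'I_N -> 'cV[R]_2 -> 'cV[R]_2)
    (hT : forall i : 'I_N, euclidean_contraction (T i))
    (v : 'I_N -> 'cV[R]_2) (A : 'I_N -> 'M[R]_2)
    (hTA : forall (i : 'I_N) (x : 'cV[R]_2), T i x = A i *m x + v i)
    (k : nat) (hk : (k <= N)%N) (a b c d : 'I_N -> R)
    (hdiag : forall i : 'I_N, (i < k)%N ->
       A i = mx2 (a i) 0 0 (d i) /\ a i != 0 /\ d i != 0)
    (hanti : forall i : 'I_N, (k <= i)%N ->
       A i = mx2 0 (b i) (c i) 0 /\ b i != 0 /\ c i != 0) :
  exists s : R, is_affinity_dimension A s /\
    unique (fun t : R => 0 < t /\
      [\/ spectral_radius
            (mx2 (\sum_(i < N | (i < k)%N) `|a i| `^ t)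
                 (\sum_(i < N | (k <= i)%N) `|b i| `^ t)
                 (\sum_(i < N | (k <= i)%N) `|c i| `^ t)
                 (\sum_(i < N | (i < k)%N) `|d i| `^ t)) = 1
          /\ 0 < t <= 1,
          spectral_radius
            (mx2 (\sum_(i < N | (i < k)%N) `|a i| * `|d i| `^ (t - 1))
                 (\sum_(i < N | (k <= i)%N) `|b i| * `|c i| `^ (t - 1))
                 (\sum_(i < N | (k <= i)%N) `|b i| `^ (t - 1) * `|c i|)
                 (\sum_(i < N | (i < k)%N) `|a i| `^ (t - 1) * `|d i|)) = 1
          /\ 1 <= t <= 2
        | \sum_(i < N) `|\det (A i)| `^ (t / 2) = 1 /\ 2 <= t]) s.
Proof.
pose e (i : 'I_N) := (k <= i)%N.
pose x i := if e i then b i else a i.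
pose y i := if e i then c i else d i.
have AE i : A i = gperm (e i) (x i) (y i).
  rewrite /gperm /x /y /e; case: leqP => ki; first by case: (hanti i ki).
  by case: (hdiag i ki).
have eN (i : 'I_N) : (i < k)%N = ~~ e i by rewrite ltnNge.
have xy0 i : x i != 0 /\ y i != 0.
  rewrite /x /y /e; case: leqP => ki; first by case: (hanti i ki).
  by case: (hdiag i ki).
have xy1 i : `|x i| < 1 /\ `|y i| < 1.
  have lt1 j l := affine_contraction_entry_lt1 j l (hT i) (hTA i).
  have := (lt1 ord0 ord0, lt1 ord0 ord_max, lt1 ord_max ord0, lt1 ord_max ord_max).
  by rewrite AE /gperm; case: (e i); rewrite !mxE /= => -[[[? ?] ?] ?].
have hx i : 0 < `|x i| < 1 by rewrite normr_gt0; case: (xy0 i) (xy1 i) => -> _ [].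
have hy i : 0 < `|y i| < 1 by rewrite normr_gt0; case: (xy0 i) (xy1 i) => _ -> [].
have x0 i : 0 < `|x i| by case/andP: (hx i).
have y0 i : 0 < `|y i| by case/andP: (hy i).
have [s [s0 rootE]] := growth_rate_root e hN hx hy.
have growth1 t : growth_rate e x y t = 1 <-> t = s.
  rewrite -rootE; split => [->|/eqP]; first exact: ln1.
  by rewrite ln_eq0 ?growth_rate_gt0 ?(ltnW hN) // => /eqP.
have pressureA t : 0 <= t -> pressure_is A t (ln (growth_rate e x y t))%:E.
  by rewrite (_ : A = fun i => gperm (e i) (x i) (y i)); [apply: pressure_gperm => //; exact: ltnW|apply/funext].
have growthE t : growth_rate e x y t = rho
    (\sum_(i < N | (i < k)%N) wt t `|a i| `|d i|) (\sum_(i < N | (k <= i)%N) wt t `|b i| `|c i|)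
    (\sum_(i < N | (k <= i)%N) wt t `|c i| `|b i|) (\sum_(i < N | (i < k)%N) wt t `|d i| `|a i|).
  rewrite /growth_rate -!(eq_bigl _ _ eN).
  have xyd (i : 'I_N) : (i < k)%N -> x i = a i /\ y i = d i by rewrite /x /y eN => /negPf ->.
  have xya (i : 'I_N) : (k <= i)%N -> x i = b i /\ y i = c i by rewrite /x /y /e => ->.
  by congr rho; apply: eq_bigr => i; [case/xyd|case/xya|case/xya|case/xyd] => -> ->.
have case1 t : t <= 1 -> spectral_radius
            (mx2 (\sum_(i < N | (i < k)%N) `|a i| `^ t)
                 (\sum_(i < N | (k <= i)%N) `|b i| `^ t)
                 (\sum_(i < N | (k <= i)%N) `|c i| `^ t)
                 (\sum_(i < N | (i < k)%N) `|d i| `^ t)) = growth_rate e x y t.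
  move=> t1; rewrite spectral_radius_mx2; try by apply: sumr_ge0 => i _; exact: powR_ge0.
  by rewrite growthE; congr rho; apply: eq_bigr => i _; rewrite /wt /c1 /c2 t1 powRr0 mulr1.
have case2 t : 1 <= t <= 2 -> spectral_radius
            (mx2 (\sum_(i < N | (i < k)%N) `|a i| * `|d i| `^ (t - 1))
                 (\sum_(i < N | (k <= i)%N) `|b i| * `|c i| `^ (t - 1))
                 (\sum_(i < N | (k <= i)%N) `|b i| `^ (t - 1) * `|c i|)
                 (\sum_(i < N | (i < k)%N) `|a i| `^ (t - 1) * `|d i|)) =
    growth_rate e x y t.
  move=> /andP[t1 t2].
  (* At t = 1 the exponents come from their first branch, which agrees there with the second. *)
  have wtE u w : 0 <= u -> wt t u w = u * w `^ (t - 1).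
    move=> u0; rewrite /wt /c1 /c2 t2; case: leP => [t1'|]; last by rewrite powRr1.
    have -> : t = 1 by apply/le_anti/andP.
    by rewrite subrr powRr1.
  rewrite spectral_radius_mx2; try by apply: sumr_ge0 => i _; rewrite mulr_ge0 ?powR_ge0.
  by rewrite growthE; congr rho; apply: eq_bigr => i _; rewrite wtE // mulrC.
have case3 t : 2 <= t -> \sum_(i < N) `|\det (A i)| `^ (t / 2) = growth_rate e x y t.
  move=> t2.
  (* From t = 2 on both exponents equal t / 2, so the weight is symmetric and the matrix circulant;
     at t = 2 the middle branch gives the same value 1. *)
  have wtE u w : 0 <= u -> 0 <= w -> wt t u w = (u * w) `^ (t / 2).
    move=> u0 w0; rewrite powRM // /wt /c1 /c2.
    have -> : (t <= 1) = false by apply/negbTE; rewrite -ltNge; lra.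
    case: leP => // t2'; have -> : t = 2 by apply/le_anti/andP.
    by rewrite divff // (_ : 2 - 1 = 1) //; ring.
  have sumE (P : pred 'I_N) : \sum_(i | P i) wt t `|y i| `|x i| = \sum_(i | P i) wt t `|x i| `|y i|.
    by apply: eq_bigr => i _; rewrite !wtE // mulrC.
  rewrite /growth_rate !sumE rho_circulant ?sumr_ge0 // => [|i _]; last by rewrite wtE ?powR_ge0.
  rewrite (bigID e) /= addrC; congr (_ + _); apply: eq_bigr => i _;
    by rewrite AE det_gperm wtE.
exists s; split.
  split; first by split; [exact: ltW|have := pressureA s (ltW s0); rewrite ((rootE s).2 erefl)].
  move=> t [t0 Pt]; apply/esym/rootE.
  (* Uniqueness of limits forces the logarithm of the growth rate at t to be 0. *)
  move: (pressureA t t0) Pt; rewrite /pressure_is => /(cvg_unique (@ereal_hausdorff R)) H /H.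
  by case.
split.
  split=> //; have Gs : growth_rate e x y s = 1 by apply/growth1.
  have [s1|/ltW s1] := leP s 1; first by constructor 1; rewrite case1 // s0.
  have [s2|/ltW s2] := leP s 2; first by constructor 2; rewrite case2 s1.
  by constructor 3; rewrite case3.
move=> t [t0]; move=> [[E /andP[_ t1]]|[E t12]|[E t2]]; apply/esym/growth1.
- by rewrite -case1.
- by rewrite -case2.
- by rewrite -case3.
Qed.
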